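(* Let $R, R_1,\dots,R_r$ ($r \ge 1$) be finite commutative rings with $1\neq 0$, each $R_i$ local, such that $R \cong R_1\times\cdots\times R_r$. Then $$\Gamma(R) \;\cong\; \Gamma(R_1)\times_\Gamma \cdots \times_\Gamma \Gamma(R_r)$$ as graphs (with loops).
   Context: All graphs are undirected, may have loops, and have no multiple edges. For a finite commutative ring $R$ with $1\ne 0$, let $Z^*(R)$ be the set of non-zero zero-divisors of $R$ and $U(R)$ its set of units. The zero-divisor graph $\Gamma(R)$ has vertex set $Z^*(R)$, and two (not necessarily distinct) vertices $x,y$ are adjacent iff $xy=0$; so there is a loop at $x$ iff $x^2=0$. Graph operations. The direct product $G_1\times G_2$ has vertex set $V(G_1)\times V(G_2)$, with $(v_1,v_2)$ adjacent to $(v_1',v_2')$ iff $v_1$ is adjacent to $v_1'$ in $G_1$ and $v_2$ is adjacent to $v_2'$ in $G_2$. The complete product $G_1\nabla G_2$ has vertex set the disjoint union $V(G_1)\cup V(G_2)$; its edges are those of $G_1$, those of $G_2$, and all edges between a vertex of $G_1$ and a vertex of $G_2$. If $v$ is a vertex of both $G_1$ and $G_2$, then $G_1\overset{v}{\bullet}G_2$ is the graph obtained from the disjoint union of $G_1$ and $G_2$ by identifying the two copies of $v$. For $S \subseteq V(G)$, $G\setminus S$ is the graph obtained by deleting the vertices in $S$ and all edges incident to them. Let $\mathrm U(R)$, as a graph, be the graph with vertex set $U(R)$ and no edges (the unit graph); let $\mathrm Z(R)$ be the graph with the single vertex $0\in R$ and no edges, and $\mathrm{Z_L}(R)$ the graph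 with the single vertex $0\in R$ and a loop at it. The extended zero-divisor graph is $$\mathrm{E}\Gamma(R) = \big(\Gamma(R)\nabla \mathrm Z(R)\big)\overset{0}{\bullet}\big(\mathrm U(R)\nabla \mathrm{Z_L}(R)\big),$$ which has vertex set $R$. For finite commutative rings $R_1,R_2$ with $1\neq 0$, define $$\Gamma(R_1)\times_\Gamma\Gamma(R_2) := \big(\mathrm{E}\Gamma(R_1)\times \mathrm{E}\Gamma(R_2)\big)\setminus\big(\{(0,0)\}\cup U(R_1\times R_2)\big).$$ The product is associative, and the $r$-fold product $\Gamma(R_1)\times_\Gamma\cdots\times_\Gamma\Gamma(R_r)$ is the graph $\mathrm{E}\Gamma(R_1)\times\cdots\times \mathrm{E}\Gamma(R_r)$ with the vertex $(0,\dots,0)$ and all vertices $(u_1,\dots,u_r)$ with $u_i\in U(R_i)$ for all $i$ deleted. *)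

(* Defs.v *)
From HB Require Import structures.
From mathcomp Require Import all_boot all_order all_algebra.

Set Implicit Arguments.
Unset Strict Implicit.
Unset Printing Implicit Defensive.

Import GRing.Theory.
Local Open Scope ring_scope.

(* A graph, possibly with loops, whose vertex set is a subset of an ambient
   finite type; adjacency is supported on that vertex set. *)
Record lgraph (T : finType) := LGraph {
  vset : {set T};
  adj : rel T;
  adj_sym : symmetric adj;
  adj_vset : forall x y, adj x y -> x \in vset
}.

Definition graph_iso (T1 T2 : finType) (G : lgraph T1) (H : lgraph T2) : Prop :=
  exists f : {x : T1 | x \in vset G} -> {y : T2 | y \in vset H},
    bijective f /\ forall x y, adj H (val (f x)) (val (f y)) = adj G (val x) (val y).

Section Operations.
Variable T : finType.
Implicit Types (G H : lgraph T) (S : {set T}).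

Definition edgeless S : lgraph T.
Proof. by refine (@LGraph T S (fun _ _ => false) _ _). Defined.

Definition loop_graph (v : T) : lgraph T.
Proof.
refine (@LGraph T [set v] (fun x y => (x == v) && (y == v)) _ _).
- by move=> x y; rewrite andbC.
- by move=> x y /andP[xv _]; rewrite inE.
Defined.

(* The complete product lives on the disjoint union of the two vertex sets;
   inside a common ambient type this is the plain union, provided the vertex
   sets are disjoint, which is therefore required. *)
Definition cprod G H (dGH : [disjoint vset G & vset H]) : lgraph T.
Proof.
refine (@LGraph T (vset G :|: vset H)
  (fun x y => [|| adj G x y, adj H x y,
                  (x \in vset G) && (y \in vset H)
                | (x \in vset H) && (y \in vset G)]) _ _).
- move=> x y; rewrite (adj_sym G) (adj_sym H); do 2!congr (_ || _).
  by rewrite orbC [_ && (x \in _)]andbC [X in _ || X]andbC.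
- move=> x y; rewrite inE => /or4P[/adj_vset-> //|/adj_vset->|/andP[-> _] //|/andP[-> _]];
  by rewrite orbT.
Defined.

(* The disjoint union of G and H with the two copies of v identified is the
   plain union exactly when v is the only common vertex, which is required. *)
Definition glue (v : T) G H (eGH : vset G :&: vset H = [set v]) : lgraph T.
Proof.
refine (@LGraph T (vset G :|: vset H) (fun x y => adj G x y || adj H x y) _ _).
- by move=> x y; rewrite (adj_sym G) (adj_sym H).
- by move=> x y; rewrite inE => /orP[] /adj_vset->; rewrite ?orbT.
Defined.

Definition del_vertices G S : lgraph T.
Proof.
refine (@LGraph T (vset G :\: S)
  (fun x y => [&& x \notin S, y \notin S & adj G x y]) _ _).
- by move=> x y; rewrite (adj_sym G) andbCA.
- by move=> x y /and3P[xS _ /adj_vset xG]; rewrite inE xS.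
Defined.

End Operations.

Definition direct_prod (I : finType) (T : I -> finType)
  (G : forall i, lgraph (T i)) : lgraph {dffun forall i, T i}.
Proof.
refine (@LGraph {dffun forall i, T i}
  [set f : {dffun forall i, T i} | [forall i, f i \in vset (G i)]]
  (fun f g => [forall i, adj (G i) (f i) (g i)]) _ _).
- by move=> f g; apply: eq_forallb => i; rewrite adj_sym.
- by move=> f g /forallP adjfg; rewrite inE; apply/forallP => i;
    apply: adj_vset (adjfg i).
Defined.

Section Rings.
Variable R : finComUnitRingType.

Definition zdiv_set : {set R} :=
  [set x | (x != 0) && [exists y, (y != 0) && (x * y == 0)]].

Definition unit_set : {set R} := [set x | x \is a GRing.unit].

Lemma zdiv_set_unitN x : x \in zdiv_set -> x \notin unit_set.
Proof.
rewrite !inE => /andP[_ /existsP[y /andP[y0 /eqP xy0]]]; apply: contra y0 => Ux.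
by rewrite -(mulKr Ux y) xy0 mulr0.
Qed.

Definition zd_graph : lgraph R.
Proof.
refine (@LGraph R zdiv_set
  (fun x y => [&& x \in zdiv_set, y \in zdiv_set & x * y == 0]) _ _).
- by move=> x y; rewrite andbCA mulrC.
- by move=> x y /and3P[].
Defined.

Definition unit_graph : lgraph R := edgeless unit_set.
Definition zero_graph : lgraph R := edgeless [set 0].
Definition zero_loop_graph : lgraph R := loop_graph 0.

Lemma zd_zero_disjoint : [disjoint vset zd_graph & vset zero_graph].
Proof. by rewrite disjoint_sym disjoints1 !inE eqxx. Qed.

Lemma unit_zero_disjoint : [disjoint vset unit_graph & vset zero_loop_graph].
Proof. by rewrite disjoint_sym disjoints1 inE unitr0. Qed.

Lemma ezd_common_vertex :
  vset (cprod zd_zero_disjoint) :&: vset (cprod unit_zero_disjoint) = [set 0].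
Proof.
rewrite /= -setUIl; apply/setP=> x; rewrite inE in_setI.
by case: (boolP (x \in zdiv_set)) => [/zdiv_set_unitN/negPf->|].
Qed.

Definition ezd_graph : lgraph R := glue ezd_common_vertex.

Lemma vset_ezd_graph : vset ezd_graph = [set: R].
Proof.
apply/setP=> x; rewrite !inE; have [//|x0 /=] := eqVneq x 0.
rewrite !orbF; case: existsP => //= noy.
have injx : injective (fun y => x * y).
  move=> y z /= /eqP; rewrite -subr_eq0 -mulrBr => xyz; apply/eqP.
  rewrite -subr_eq0; apply: contraPT xyz => yz xyz; apply: noy.
  by exists (y - z); rewrite yz.
by apply/unitrPr; exists (invF injx 1); rewrite (f_invF injx).
Qed.

End Rings.

Definition gamma_prod (I : finType) (R : I -> finComUnitRingType) :
  lgraph {dffun forall i, R i} :=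
  del_vertices (direct_prod (fun i => ezd_graph (R i)))
    ([set u : {dffun forall i, R i} | [forall i, u i == 0]]
     :|: [set u : {dffun forall i, R i} | [forall i, u i \in unit_set (R i)]]).

(* idealr_closed includes that the ideal is proper. *)
Definition maximal_ideal (R : finComUnitRingType) (I : {set R}) : Prop :=
  idealr_closed I /\
  forall J : {set R}, idealr_closed J -> I \subset J -> J = I.

Definition local_ring (R : finComUnitRingType) : Prop :=
  exists! M : {set R}, maximal_ideal M.

Section RingProduct.
Variables (I : finType) (R : I -> finComUnitRingType).

(* The product of the R i, with componentwise operations.  The index type may
   be empty, so this is only a possibly zero ring. *)
Definition ring_prod : Type := {dffun forall i, R i}.
HB.instance Definition _ := Finite.on ring_prod.

Implicit Types f g h : ring_prod.
Definition rp_zero : ring_prod := [ffun i => 0].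
Definition rp_one : ring_prod := [ffun i => 1].
Definition rp_opp f : ring_prod := [ffun i => - f i].
Definition rp_add f g : ring_prod := [ffun i => f i + g i].
Definition rp_mul f g : ring_prod := [ffun i => f i * g i].

Fact rp_addA : associative rp_add.
Proof. by move=> f g h; apply/ffunP => i; rewrite !ffunE addrA. Qed.
Fact rp_addC : commutative rp_add.
Proof. by move=> f g; apply/ffunP => i; rewrite !ffunE addrC. Qed.
Fact rp_add0 : left_id rp_zero rp_add.
Proof. by move=> f; apply/ffunP => i; rewrite !ffunE add0r. Qed.
Fact rp_addN : left_inverse rp_zero rp_opp rp_add.
Proof. by move=> f; apply/ffunP => i; rewrite !ffunE addNr. Qed.
HB.instance Definition _ :=
  GRing.isZmodule.Build ring_prod rp_addA rp_addC rp_add0 rp_addN.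

Fact rp_mulA : associative rp_mul.
Proof. by move=> f g h; apply/ffunP => i; rewrite !ffunE mulrA. Qed.
Fact rp_mulC : commutative rp_mul.
Proof. by move=> f g; apply/ffunP => i; rewrite !ffunE mulrC. Qed.
Fact rp_mul1 : left_id rp_one rp_mul.
Proof. by move=> f; apply/ffunP => i; rewrite !ffunE mul1r. Qed.
Fact rp_mulD : left_distributive rp_mul rp_add.
Proof. by move=> f g h; apply/ffunP => i; rewrite !ffunE mulrDl. Qed.
HB.instance Definition _ :=
  GRing.Zmodule_isComPzRing.Build ring_prod rp_mulA rp_mulC rp_mul1 rp_mulD.

End RingProduct.

Definition ring_iso (R S : pzRingType) : Prop :=
  exists f : {rmorphism R -> S}, bijective f.

(* Main.v *)
Require Import Defs.
From HB Require Import structures.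
From mathcomp Require Import all_boot all_order all_algebra.

Set Implicit Arguments.
Unset Strict Implicit.
Unset Printing Implicit Defensive.

Import GRing.Theory.
Local Open Scope ring_scope.

(** In a finite ring every element is zero, a unit, or a nonzero zero-divisor,
    so in the extended graph on R two elements are adjacent exactly when their
    product is 0.  The direct product of the extended graphs therefore encodes
    "f g = 0" in the product ring, and the deleted vertices are exactly its zero
    and its units.  Any ring isomorphism onto the product ring preserves all of
    these notions, hence restricts to the required graph isomorphism. *)

Lemma graph_iso_bij (T1 T2 : finType) (G : lgraph T1) (H : lgraph T2)
    (f : T1 -> T2) :
  bijective f -> (forall x, (f x \in vset H) = (x \in vset G)) ->
  {in vset G &, forall x y, adj H (f x) (f y) = adj G x y} ->
  graph_iso G H.
Proof.
case=> g fK gK vf adjf.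
have fP (u : {x | x \in vset G}) : f (val u) \in vset H by rewrite vf (valP u).
have gP (v : {y | y \in vset H}) : g (val v) \in vset G.
  by rewrite -vf gK (valP v).
exists (fun u => Sub (f (val u)) (fP u)); split; last first.
  by move=> u v; rewrite !SubK adjf ?(valP u) ?(valP v).
exists (fun v => Sub (g (val v)) (gP v)) => u; apply: val_inj.
  by rewrite !SubK fK.
by rewrite !SubK gK.
Qed.

(** Finiteness of [R] enters through [vset_ezd_graph]: zero, zero-divisors and units exhaust the
    ring. *)
Lemma in_zdiv_set (R : finComUnitRingType) (x : R) :
  (x \in zdiv_set R) = (x != 0) && (x \notin unit_set R).
Proof.
have [xZ|xNZ] := boolP (x \in zdiv_set R).
  by rewrite (zdiv_set_unitN xZ) andbT; move: xZ; rewrite inE => /andP[->].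
have := in_setT x; rewrite -vset_ezd_graph /= !in_setU (negPf xNZ) !inE /=.
by case: (x == 0) => //=; rewrite orbF => ->.
Qed.

Lemma adj_ezd_graph (R : finComUnitRingType) (x y : R) :
  adj (ezd_graph R) x y = (x * y == 0).
Proof.
rewrite /= !in_zdiv_set !inE.
(* The two complete products join 0 to every other element, and the loop covers the pair of
   zeros. *)
have [->|x0] := eqVneq x 0.
  by rewrite mul0r unitr0 eqxx /=; case: (y == 0); case: (y \is a GRing.unit).
have [->|y0] := eqVneq y 0.
  by rewrite mulr0 unitr0 eqxx /= !andbT; case: (x \is a GRing.unit).
rewrite /= !andbF !orbF.
(* A unit is cancellable, so its product with a nonzero element is nonzero, matching the absence of
   an edge. *)
have [Ux|] := boolP (x \is a GRing.unit).
  by rewrite mulrI_eq0 ?(negPf y0) //; apply: mulrI.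
have [Uy|] := boolP (y \is a GRing.unit).
  by rewrite mulIr_eq0 ?(negPf x0) //; apply: mulIr.
by [].
Qed.

Section ProductGraph.
Variables (I : finType) (R : I -> finComUnitRingType).
Implicit Types f g : ring_prod R.

Lemma ring_prod_eq0 f : [forall i, f i == 0] = (f == 0).
Proof.
apply/forallP/eqP => [f0|-> i]; last by rewrite ffunE.
by apply/ffunP => i; rewrite ffunE; apply/eqP.
Qed.

(** [ring_prod] has only a commutative ring structure, so invertibility is phrased as existence of
    an inverse, a form that ring isomorphisms preserve. *)
Lemma ring_prod_unitP f :
  reflect (exists g, f * g = 1) [forall i, f i \in unit_set (R i)].
Proof.
apply: (iffP forallP) => [Uf|[g fg1] i].
  exists [ffun i => (f i)^-1]; apply/ffunP => i; rewrite !ffunE divrr //.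
  by have := Uf i; rewrite inE.
rewrite inE; apply/unitrPr; exists (g i).
by have /ffunP/(_ i) := fg1; rewrite !ffunE.
Qed.

Lemma in_vset_gamma_prod f :
  (f \in vset (gamma_prod R)) =
  (f != 0) && ~~ [forall i, f i \in unit_set (R i)].
Proof.
(* The added [true] matches membership in the direct product, which always holds. *)
rewrite in_setD in_setU !in_set ring_prod_eq0 negb_or -[RHS]andbT; congr (_ && _).
by apply/forallP => i; rewrite vset_ezd_graph in_setT.
Qed.

Lemma adj_gamma_prod f g :
  f \in vset (gamma_prod R) -> g \in vset (gamma_prod R) ->
  adj (gamma_prod R) f g = (f * g == 0).
Proof.
move=> /setDP[_ fN] /setDP[_ gN].
rewrite [LHS]/= fN gN -ring_prod_eq0; apply: eq_forallb => i.
by rewrite ffunE; apply: adj_ezd_graph.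
Qed.

End ProductGraph.

Theorem mainTheorem1 (r : nat) (r_gt0 : (0 < r)%N)
  (R : finComUnitRingType) (Ri : 'I_r -> finComUnitRingType)
  (Ri_local : forall i, local_ring (Ri i))
  (R_iso : ring_iso R (ring_prod Ri)) :
  graph_iso (zd_graph R) (gamma_prod Ri).
Proof.
have [f f_bij] := R_iso; have f_inj := bij_inj f_bij.
have f_eq0 x : (f x == 0) = (x == 0) by rewrite -(inj_eq f_inj) rmorph0.
have f_vset x : (f x \in vset (gamma_prod Ri)) = (x \in vset (zd_graph R)).
  rewrite in_vset_gamma_prod f_eq0 in_zdiv_set; congr (_ && ~~ _).
  (* An inverse of [f x] is pulled back along the inverse map of [f]; an inverse of [x] is pushed
     forward by [f]. *)
  rewrite inE; apply/ring_prod_unitP/unitrPr => -[y xy1].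
    have [g _ gK] := f_bij; exists (g y); apply: f_inj.
    by rewrite rmorphM gK xy1 rmorph1.
  by exists (f y); rewrite -rmorphM xy1 rmorph1.
apply: (graph_iso_bij f_bij f_vset) => x y xZ yZ.
by rewrite adj_gamma_prod ?f_vset // -rmorphM f_eq0 /= xZ yZ.
Qed.
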